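(* Let $X_1,X_2,\ldots$ be i.i.d. random variables with distribution function $F$ having finite right endpoint $x^F$, and let $U$ be the associated tail quantile function. Suppose there is a positive slowly varying function $a$ on $(0,\infty)$, integrable over finite intervals, with $\int_t^\infty a(s)\,\frac{ds}{s}<\infty$ for every $t>0$, such that $$U(\infty)-U(t)=\int_t^\infty a(s)\,\frac{ds}{s}+o\bigl(a(t)\bigr),\qquad t\to\infty,$$ where $U(\infty)=\lim_{t\to\infty}U(t)=x^F$. Let $k=k(n)$ be a sequence of positive integers such that $k(n)\to\infty$ and $k(n)/n\to0$ as $n\to\infty$. Then the estimator $\hat x^F:=X_{n-k,n}+\hat q(n/k)$ is consistent for $x^F$, i.e. $$\hat x^F\to x^F\quad\text{in probability as } n\to\infty.$$
   Context: The right endpoint is $x^F:=\sup\{x: F(x)<1\}$. The tail quantile function $U$ is the (generalized, left-continuous) inverse of $1/(1-F)$. A positive measurable function $a$ is slowly varying if $a(tx)/a(t)\to1$ as $t\to\infty$ for every $x>0$. $X_{1,n}\le X_{2,n}\le\dots\le X_{n,n}$ denote the order statistics of $X_1,\ldots,X_n$. For $n$ large enough that $2k\le n$, define $$\hat q\Bigl(\frac nk\Bigr):=X_{n,n}+\frac1{\log 2}\sum_{i=0}^{k-1}\log\Bigl(\frac{k+i}{k+i+1}\Bigr)X_{n-k-i,n}.$$ *)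

(* Defs.v *)
From HB Require Import structures.
From mathcomp Require Import all_boot all_order all_algebra.
From mathcomp Require Import finmap.
From mathcomp Require Import all_classical all_reals all_analysis.

Set Implicit Arguments.
Unset Strict Implicit.
Unset Printing Implicit Defensive.

Import Order.TTheory GRing.Theory Num.Theory.
Import numFieldNormedType.Exports.

Local Open Scope classical_set_scope.
Local Open Scope ring_scope.

Definition mutually_independent d (T : measurableType d) (R : realType)
    (P : probability T R) (X : nat -> {RV P >-> R}) : Prop :=
  forall (J : {fset nat}) (A : nat -> set R),
    (forall i, measurable (A i)) ->
    P (\bigcap_(i in [set` J]) (X i @^-1` A i)) =
      (\prod_(i <- J) P (X i @^-1` A i))%E.

Definition iid_with_cdf d (T : measurableType d) (R : realType)
    (P : probability T R) (X : nat -> {RV P >-> R}) (F : R -> R) : Prop :=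
  mutually_independent X /\ (forall i x, cdf (X i) x = (F x)%:E).

Definition cvg_in_probability d (T : measurableType d) (R : realType)
    (P : probability T R) (Y : nat -> T -> R) (c : R) : Prop :=
  forall eps : R, 0 < eps ->
    P [set w | eps < `|Y n w - c|] @[n --> \oo] --> (0 : \bar R).

(* Lets the Landau notations be used along the filter +oo. *)
Canonical pinfty_filter_on (R : realType) : filter_on R :=
  FilterType (pinfty_nbhs R) (@filter_filter _ _ (@proper_pinfty_nbhs _)).

Definition right_endpoint (R : realType) (F : R -> R) : \bar R :=
  ereal_sup [set x%:E | x in [set x | F x < 1]].

(* Generalized left-continuous inverse of 1 / (1 - F).  The reciprocal is taken
   in \bar R, so that it is +oo wherever F x = 1 (the inverse of 0 in R is 0).
   When F is a cdf, the value is finite for every t > 1. *)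
Definition tail_quantile (R : realType) (F : R -> R) (t : R) : \bar R :=
  ereal_inf [set x%:E | x in [set x | (t%:E <= (1 - F x)%:E^-1)%E]].

Definition tail_quantile_infty (R : realType) (F : R -> R) : \bar R :=
  lim (tail_quantile F t @[t --> +oo%R]).

(* Positivity and measurability are only required on (0, +oo); the values of
   [a] elsewhere are irrelevant. *)
Definition slowly_varying (R : realType) (a : R -> R) : Prop :=
  [/\ forall t : R, 0 < t -> 0 < a t,
      measurable_fun (`]0, +oo[ : set R) a &
      forall x : R, 0 < x -> a (t * x) / a t @[t --> +oo] --> (1 : R)].

(* The j-th smallest (1 <= j <= n) of the sample x 0, ..., x n.-1. *)
Definition order_stat (R : realType) (x : nat -> R) (n j : nat) : R :=
  nth 0 (sort <=%R (mkseq x n)) j.-1.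

(* The subtractions in [n - k - i] are exact, with n - k - i >= 1, as soon as
   2 * k <= n. *)
Definition q_hat (R : realType) (x : nat -> R) (n k : nat) : R :=
  order_stat x n n +
  (ln 2)^-1 * \sum_(0 <= i < k)
     ln ((k + i)%:R / (k + i + 1)%:R) * order_stat x n (n - k - i).

Definition endpoint_hat (R : realType) (x : nat -> R) (n k : nat) : R :=
  order_stat x n (n - k) + q_hat x n k.

(* Main.v *)
(* The weights log((k+i+1)/(k+i)) / log 2, i < k, telescope to a total mass of 1,
   so the estimator is X_{n,n} + X_{n-k,n} minus a weighted mean of the X_{n-k-i,n}.
   All these order statistics lie almost surely between X_{n-2k+1,n} and x^F, so
   the error is at most 2 (x^F - X_{n-2k+1,n}).  Given t < x^F, the number of the
   first n observations exceeding t has mean n (1 - F t) and variance at most n, so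
   by Chebyshev's inequality it exceeds 2k = o(n) with probability tending to 1,
   and then X_{n-2k+1,n} > t. *)
Require Import Defs.
From HB Require Import structures.
From mathcomp Require Import all_boot all_order all_algebra.
From mathcomp Require Import finmap zify ring lra.
From mathcomp Require Import all_classical all_reals all_analysis measurable_realfun.

Import Order.TTheory GRing.Theory Num.Theory.
Import numFieldNormedType.Exports.

Local Open Scope classical_set_scope.
Local Open Scope ring_scope.

(** * Measurability of sets cut out by comparing two functions *)

Lemma measurable_set_ltr {d : measure_display} {T : measurableType d}
    {R : realType} (f g : T -> R) :
  measurable_fun setT f -> measurable_fun setT g ->
  measurable [set w | f w < g w].
Proof.
move=> mf mg; rewrite -[X in measurable X]setTI.
exact: (measurable_fun_ltr mf mg measurableT (Y := [set true])).
Qed.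

Lemma measurable_set_ler {d : measure_display} {T : measurableType d}
    {R : realType} (f g : T -> R) :
  measurable_fun setT f -> measurable_fun setT g ->
  measurable [set w | f w <= g w].
Proof.
move=> mf mg; rewrite -[X in measurable X]setTI.
exact: (measurable_fun_ler mf mg measurableT (Y := [set true])).
Qed.

(** * Counts of pairwise independent events: moments and a lower tail bound *)

Section pairwise_independent_events.
Context {d : measure_display} {T : measurableType d} {R : realType}.
Variable P : probability T R.

Lemma indic_Lfun2 (A : set T) : measurable A -> \1_A \in Lfun P 2%:E.
Proof.
move=> mA; rewrite inE; apply/andP; split; rewrite inE/=.
  exact: measurable_indic.
rewrite /finite_norm unlock poweR_lty//.
under eq_integral => x _.
  rewrite /= ger0_norm ?indicE ?ler0n// powR_mulrn ?ler0n//.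
  have -> : ((x \in A)%:R ^+ 2 : R) = \1_A x.
    by rewrite indicE; case: (x \in A); rewrite ?expr1n ?expr0n.
  over.
by rewrite integral_indic// setIT ltey_eq fin_num_measure.
Qed.

Lemma indicM (A B : set T) : \1_A * \1_B = \1_(A `&` B) :> (T -> R).
Proof. by rewrite indicI. Qed.

(** Real-valued rather than in [nat], so that expectation and variance apply to it. *)
Definition hits (A : nat -> set T) (n : nat) (w : T) : R :=
  \sum_(i < n) \1_(A i) w.

Lemma hitsS A n : hits A n.+1 = (hits A n \+ \1_(A n))%R.
Proof. by apply/funext => w; rewrite /hits big_ord_recr. Qed.

Lemma hits0 A : hits A 0 = cst 0.
Proof. by apply/funext => w; rewrite /hits big_ord0. Qed.

Variables (A : nat -> set T) (p : R).
Hypothesis mA : forall i, measurable (A i).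
Hypothesis PA : forall i, P (A i) = p%:E.
Hypothesis PAA : forall i j, i != j -> P (A i `&` A j) = (p * p)%:E.

Lemma measurable_hits n : measurable_fun setT (hits A n).
Proof. by apply: measurable_sum => i; exact: measurable_indic. Qed.

Lemma hits_Lfun2 n : hits A n \in Lfun P 2%:E.
Proof.
elim: n => [|n IH]; first by rewrite hits0; exact: Lfun_cst.
rewrite hitsS.
have [_ h] := @Lfun_addr_closed _ _ _ P 2%:E ltac:(by rewrite lee_fin ler1n).
by apply: h => //; exact: indic_Lfun2.
Qed.

Let Lfun21 (f : T -> R) : f \in Lfun P 2%:E -> f \in Lfun P 1.
Proof. by apply: Lfun_subset12; exact: fin_num_measure. Qed.

Lemma expectation_hits n : 'E_P[hits A n]%E = (n%:R * p)%:E.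
Proof.
elim: n => [|n IH]; first by rewrite hits0 expectation_cst mul0r.
rewrite hitsS expectationD; last 2 first.
- exact/Lfun21/hits_Lfun2.
- exact/Lfun21/indic_Lfun2.
by rewrite IH expectation_indic// PA -EFinD -natr1 mulrDl mul1r.
Qed.

Lemma covariance_indic i j : i != j -> covariance P \1_(A i) \1_(A j) = 0%E.
Proof.
move=> ij; rewrite covarianceE.
- rewrite indicM !expectation_indic//; last exact: measurableI.
  by rewrite PAA// !PA -EFinM subee.
- exact/Lfun21/indic_Lfun2.
- exact/Lfun21/indic_Lfun2.
- by apply: Lfun2_mul_Lfun1; exact: indic_Lfun2.
Qed.

(** Additivity reduces this to pairs of indicators; [n <= m] keeps [m] distinct from every index
    counted in [hits A n]. *)
Lemma covariance_hits n m : (n <= m)%N ->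
  covariance P (hits A n) \1_(A m) = 0%E.
Proof.
elim: n => [|n IH] nm; first by rewrite hits0 covariance_cst_l.
rewrite hitsS covarianceDl; try exact: hits_Lfun2; try exact: indic_Lfun2.
by rewrite IH ?(ltnW nm)// covariance_indic ?add0e// neq_ltn nm.
Qed.

(** Each new indicator is uncorrelated with the earlier count, so variances add, and each
    contributes [p - p ^+ 2], which is at most 1. *)
Lemma variance_hits n : ('V_P[hits A n] <= n%:R%:E)%E.
Proof.
elim: n => [|n IH]; first by rewrite hits0 variance_cst.
rewrite hitsS varianceD; [|exact: hits_Lfun2|exact: indic_Lfun2].
rewrite covariance_hits// mule0 adde0 -natr1 EFinD leeD//.
rewrite varianceE; last exact: indic_Lfun2.
have -> : (\1_(A n) ^+ 2 : T -> R) = \1_(A n).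
  by rewrite expr2 indicM setIid.
rewrite expectation_indic// PA -EFin_expe -EFinB lee_fin.
have p1 : p <= 1 by rewrite -lee_fin -(PA n); exact: probability_le1.
by rewrite lerBlDr (le_trans p1)// lerDl sqr_ge0.
Qed.

(** Chebyshev's inequality, whose two-sided event contains this one-sided one, combined with
    [variance_hits]. *)
Lemma hits_lower_tail n (e : R) : 0 < e ->
  (P [set w | (hits A n w <= n%:R * p - e)%R] <= (n%:R / e ^+ 2)%:E)%E.
Proof.
move=> e0.
have mH : hits A n \in mfun by rewrite inE; exact: measurable_hits.
pose H : {RV P >-> R} := mfun_Sub mH.
have := @chebyshev _ _ _ P H _ e0.
rewrite [in X in (X <= _)%E](_ : fine _ = n%:R * p); last first.
  by rewrite (expectation_hits n).
move=> cheb; apply: (@le_trans _ _ ((e ^- 2)%:E * 'V_P[H])%E); last first.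
  rewrite mulrC EFinM lee_pmul2l//; first exact: variance_hits.
  by rewrite lte_fin invr_gt0 exprn_gt0.
apply: le_trans cheb; apply: le_measure; rewrite ?inE.
- exact: measurable_set_ler (measurable_hits n) (measurable_cst _).
- apply: measurable_set_ler; first exact: measurable_cst.
  apply: measurableT_comp => //.
  by apply: measurable_funB => //; exact: measurable_hits.
- move=> w /= hw; rewrite ler_normr; apply/orP; right.
  by rewrite opprB lerBrDl -lerBrDr.
Qed.

End pairwise_independent_events.

(** * Order statistics of a finite sample and a deterministic error bound *)

Section order_statistics.
Context {R : realType}.
Implicit Types (x : nat -> R) (t c : R).

(** In the sorted sample the entries at most [t] form an initial segment; position [j.-1] lies
    beyond it exactly when its length is at most [j.-1]. *)
Lemma order_stat_gt x n j t : (j.-1 < n)%N ->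
  (t < order_stat x n j) = (count (<= t)%R (mkseq x n) <= j.-1)%N.
Proof.
move=> jn; rewrite /order_stat -(count_sort <=%R).
have s_sorted : sorted <=%R (sort <=%R (mkseq x n)).
  exact/sort_sorted/le_total.
have [jc|cj] := ltnP j.-1 (count _ _).
  by apply/negbTE; rewrite -leNgt; exact: nth_count_le.
by apply: nth_count_gt => //; rewrite cj size_sort size_mkseq.
Qed.

Lemma order_stat_le_count x n j t : (j.-1 < n)%N ->
  order_stat x n j <= t -> (count (> t)%R (mkseq x n) < n - j.-1)%N.
Proof.
move=> jn; rewrite leNgt order_stat_gt// -ltnNge => h.
have := count_predC (<= t)%R (mkseq x n); rewrite size_mkseq => nE.
rewrite ltn_subRL -[ltnRHS]nE (eq_count (a2 := predC (<= t)%R)) ?ltn_add2r//.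
by move=> y /=; rewrite ltNge.
Qed.

Lemma order_stat_le x n j c : (forall i, (i < n)%N -> x i <= c) ->
  (j.-1 < n)%N -> order_stat x n j <= c.
Proof.
move=> xc jn; have := mem_nth 0 (s := sort <=%R (mkseq x n)) (n := j.-1).
rewrite size_sort size_mkseq => /(_ jn); rewrite mem_sort => /mapP[i].
by rewrite mem_iota /order_stat => /andP[_ ni] ->; exact: xc.
Qed.

Lemma order_stat_homo x n i j : (i <= j)%N -> (j.-1 < n)%N ->
  order_stat x n i <= order_stat x n j.
Proof.
move=> ij jn; apply: sorted_leq_nth => //; first exact: le_trans.
- exact/sort_sorted/le_total.
- rewrite inE size_sort size_mkseq (leq_ltn_trans _ jn)//.
  by rewrite -!subn1 leq_sub2r.
- by rewrite inE size_sort size_mkseq.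
- by rewrite -!subn1 leq_sub2r.
Qed.

(** Each term is ln (k + i) - ln (k + i + 1), so the sum telescopes to ln k - ln (2 k). *)
Lemma sum_ln_weights k : (0 < k)%N ->
  \sum_(0 <= i < k) ln ((k + i)%:R / (k + i + 1)%:R) = - ln 2 :> R.
Proof.
move=> k0; have pos m : 0 < (k + m)%:R :> R by rewrite ltr0n addn_gt0 k0.
rewrite (telescope_sumr_eq (fun i => - ln (k + i)%:R))//; last first.
  by move=> i _; rewrite addn1 -addnS ln_div ?posrE ?pos// opprK addrC.
rewrite addn0 addnn -muln2 natrM lnM ?posrE ?ltr0n//; lra.
Qed.

(** The weights are nonpositive with total - ln 2, so the normalised sum lies in [-c, -t]; the other
    two terms lie in [t, c]. The error is thus between 2 (t - c) and c - t. *)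
Lemma endpoint_hat_near x n k t c : (0 < k)%N -> (2 * k <= n)%N ->
  (forall i, (i < n)%N -> x i <= c) ->
  t <= order_stat x n (n - 2 * k).+1 ->
  `|endpoint_hat x n k - c| <= 2 * (c - t).
Proof.
move=> k0 kn xc tx.
(* The estimator uses only these ranks: the smallest is n - k - (k - 1) = n - 2 k + 1. *)
have itv j : (n - 2 * k < j <= n)%N -> t <= order_stat x n j <= c.
  move=> /andP[nj jn]; have jn' : (j.-1 < n)%N by lia.
  by rewrite (le_trans tx) ?order_stat_homo ?order_stat_le.
have /andP[Mt Mc] := itv n ltac:(lia).
have /andP[Kt Kc] := itv (n - k)%N ltac:(lia).
have ln2 : 0 < ln 2 :> R by rewrite ln_gt0 ?ltr1n.
rewrite /endpoint_hat /q_hat; set S := \sum_(_ <= _ < _) _.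
have w0 i : ln ((k + i)%:R / (k + i + 1)%:R) <= 0 :> R.
  apply: ln_le0; rewrite addn1 ler_pdivrMr ?mul1r ?ler_nat ?leqnSn//.
(* A nonpositive weight reverses the order: the upper bound [c] on the order statistics bounds [S]
   from below, and [t] bounds it from above. *)
have Sc : - ln 2 * c <= S.
  rewrite -(sum_ln_weights k)// mulr_suml; apply: ler_sum_nat => i /andP[_ ik].
  by apply: ler_wnM2l => //; have /andP[] := itv (n - k - i)%N ltac:(lia).
have St : S <= - ln 2 * t.
  rewrite -(sum_ln_weights k)// mulr_suml; apply: ler_sum_nat => i /andP[_ ik].
  by apply: ler_wnM2l => //; have /andP[] := itv (n - k - i)%N ltac:(lia).
have {}Sc : - c <= (ln 2)^-1 * S.
  by rewrite mulrC ler_pdivlMr// mulNr mulrC -mulNr.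
have {}St : (ln 2)^-1 * S <= - t.
  by rewrite mulrC ler_pdivrMr// mulNr mulrC -mulNr.
by rewrite ler_norml; apply/andP; split; lra.
Qed.

End order_statistics.

(** * Measurability of the order statistics and of the estimator *)

Section sample.
Context {d : measure_display} {T : measurableType d} {R : realType}.
Variables (P : probability T R) (X : nat -> {RV P >-> R}).

(** Links list counts, which govern order statistics, to sums of indicators, to which the moment
    bounds apply. *)
Lemma hits_count (Q : pred R) n w :
  hits (fun i => X i @^-1` [set y | Q y]) n w =
  (count Q (mkseq (X^~ w) n))%:R :> R.
Proof.
rewrite /hits; elim: n => [|n IH]; first by rewrite big_ord0.
rewrite mkseqS -cats1 count_cat natrD -IH big_ord_recr /= addn0 indicE.
by congr (_ + (nat_of_bool _)%:R); apply/idP/idP; rewrite inE.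
Qed.

Lemma measurable_order_stat n j :
  measurable_fun setT (fun w => order_stat (X^~ w) n j).
Proof.
have [nj|jn] := leqP n j.-1.
  (* Out of range, [nth] returns its default 0 and the function is constant. *)
  rewrite (_ : (fun _ => _) = cst 0); first exact: measurable_cst.
  by apply/funext => w; rewrite /order_stat nth_default// size_sort size_mkseq.
(* It is enough to treat preimages of open rays, and [order_stat_gt] turns these into conditions on
   a count. *)
move=> mT; apply: (measurability _ (RGenOInfty.measurableE R)) => //.
move=> _ [_ [t ->] <-]; rewrite setTI.
rewrite (_ : _ @^-1` _ = [set w | hits (fun i => X i @^-1` [set y | y <= t]) n w
    <= (cst j.-1%:R : T -> R) w]); last first.
  apply/seteqP; split => w /=;
    by rewrite in_itv/= andbT order_stat_gt// hits_count ler_nat.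
apply: measurable_set_ler (measurable_hits _ _ n) (measurable_cst _) => i.
apply: measurable_funPTI.
by rewrite -set_interval.set_itvNyc; exact: measurable_itv.
Qed.

Lemma measurable_endpoint_hat n k :
  measurable_fun setT (fun w => endpoint_hat (X^~ w) n k).
Proof.
apply: measurable_funD; first exact: measurable_order_stat.
apply: measurable_funD; first exact: measurable_order_stat.
apply: measurable_funM; first exact: measurable_cst.
apply: measurable_sum => i; apply: measurable_funM; first exact: measurable_cst.
exact: measurable_order_stat.
Qed.

End sample.

(** * Behaviour of the distribution function at its endpoint, and the error probability *)

Section iid_sample.
Context {d : measure_display} {T : measurableType d} {R : realType}.
Variables (P : probability T R) (X : nat -> {RV P >-> R}) (F : R -> R).
Hypothesis hX : iid_with_cdf X F.

Lemma iid_cdf_le1 x : F x <= 1.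
Proof. by rewrite -lee_fin -(hX.2 0%N); exact: cdf_le1. Qed.

Lemma iid_cdf_homo : {homo F : x y / x <= y}.
Proof.
by move=> x y xy; rewrite -lee_fin -!(hX.2 0%N); exact: cdf_nondecreasing.
Qed.

Lemma tail_prob i t : P (X i @^-1` [set y | t < y]) = (1 - F t)%:E.
Proof.
have := ccdf_1_cdf (X i) t; rewrite hX.2 /ccdf /distribution /pushforward.
by rewrite set_interval.set_itvoy.
Qed.

Lemma measurable_tail i t : measurable (X i @^-1` [set y | t < y]).
Proof.
apply: measurable_funPTI.
by rewrite -set_interval.set_itvoy; exact: measurable_itv.
Qed.

(** Mutual independence on a two-element index set, with the same ray at each index. *)
Lemma tail_prob_pair i j t : i != j ->
  P (X i @^-1` [set y | t < y] `&` X j @^-1` [set y | t < y]) =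
  ((1 - F t) * (1 - F t))%:E.
Proof.
move=> ij; have /(_ [fset i; j]%fset (fun=> [set y | t < y])) := hX.1.
rewrite big_fsetU1 ?inE//= big_seq_fset1 !tail_prob -EFinM => <-.
  congr (P _); apply/seteqP; split => w /=.
    by move=> [wi wj] l /=; rewrite !inE => /orP[] /eqP ->.
  by move=> h; split; apply: h; rewrite /= !inE eqxx ?orbT.
by move=> _; rewrite -set_interval.set_itvoy; exact: measurable_itv.
Qed.

Hypothesis hxF : (right_endpoint F < +oo)%E.

(** A supremum equal to -oo would make [F] equal to 1 everywhere, against the limit 0 of a cdf at
    -oo. *)
Lemma right_endpoint_fin_num : right_endpoint F \is a fin_num.
Proof.
rewrite fin_numElt hxF andbT ltNge; apply/negP => xFNoo.
have F1 x : cdf (X 0%N) x = 1%E.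
  rewrite hX.2; congr EFin; apply/eqP; rewrite eq_le iid_cdf_le1 leNgt.
  apply/negP => Fx1; suff : (x%:E <= -oo)%E by [].
  by apply: le_trans xFNoo; apply: ereal_sup_ubound; exists x.
have h1 : cdf (X 0%N) @ -oo%R --> 1%E.
  by apply: cvg_near_cst; exact: nearW.
have /eqP : 0%E = 1%E :> \bar R.
  apply: (@cvg_unique _ (@ereal_hausdorff R) (cdf (X 0%N) @ -oo%R)) h1.
  exact: cvg_cdfNy0.
by rewrite eq_sym onee_eq0.
Qed.

Lemma cdf_lt_endpoint t : t < fine (right_endpoint F) -> F t < 1.
Proof.
rewrite -lte_fin fineK ?right_endpoint_fin_num// => /ereal_sup_gt[_ [x Fx <-]].
by rewrite lte_fin => /ltW/iid_cdf_homo/le_lt_trans; apply.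
Qed.

(** Right continuity carries the value 1 from the points beyond the endpoint to the endpoint itself;
    hence almost surely no observation exceeds it. *)
Lemma cdf_endpoint : F (fine (right_endpoint F)) = 1.
Proof.
set c := fine _; suff : cdf (X 0%N) c = 1%E by rewrite hX.2 => -[].
apply: (@cvg_unique _ (@ereal_hausdorff R) (cdf (X 0%N) x @[x --> c^'+])).
  exact: cdf_right_continuous.
apply: cvg_near_cst; near=> x; rewrite hX.2; congr EFin.
apply/eqP; rewrite eq_le iid_cdf_le1 leNgt; apply/negP => Fx1.
have : c < x by near: x; exact: nbhs_right_gt.
rewrite ltNge -lee_fin fineK ?right_endpoint_fin_num// => /negP; apply.
by apply: ereal_sup_ubound; exists x.
Unshelve. all: by end_near. Qed.

(** The choice of [t] makes the deterministic bound 2 (c - t) equal to [eps]. A larger error forces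
    the null event [U] or the event [L], bounded by Chebyshev with deviation n p / 2: n / (n p /
    2)^2 = 4 / (p^2 n). *)
Lemma endpoint_hat_tail n k eps (c := fine (right_endpoint F))
    (p := 1 - F (c - eps / 2)) : 0 < eps -> (0 < k)%N -> (2 * k <= n)%N ->
  (2 * k)%:R <= n%:R * p / 2 ->
  (P [set w | (eps < `|endpoint_hat (X^~ w) n k - c|)%R] <=
   (4 / p ^+ 2 * n%:R^-1)%:E)%E.
Proof.
move=> eps0 k0 kn knp; set t := c - eps / 2 in p knp *.
have p0 : 0 < p by rewrite subr_gt0 cdf_lt_endpoint// ltrBlDr ltrDl divr_gt0.
have n0 : 0 < n%:R :> R by rewrite ltr0n; lia.
pose U := \big[setU/set0]_(i < n) (X i @^-1` [set y | c < y]).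
pose A i := X i @^-1` [set y | t < y].
pose L := [set w | hits A n w <= n%:R * p - n%:R * p / 2].
have mU : measurable U.
  by apply: bigsetU_measurable => i _; exact: measurable_tail.
have mL : measurable L.
  apply: (measurable_set_ler _ (cst _) _ (measurable_cst _)).
  by apply: (measurable_hits A) => i; exact: measurable_tail.
have PU : P U = 0%E.
  apply/eqP; rewrite eq_le measure_ge0 andbT.
  have mUi i : (i < n)%N -> measurable (X i @^-1` [set y | c < y]).
    by move=> _; exact: measurable_tail.
  apply: le_trans (Boole_inequality P mUi) _.
  rewrite big1// => i _; apply: etrans (tail_prob i c) _.
  by rewrite cdf_endpoint subrr.
have PL : (P L <= (4 / p ^+ 2 * n%:R^-1)%:E)%E.
  have np0 : 0 < n%:R * p / 2 by rewrite divr_gt0// mulr_gt0.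
  have := hits_lower_tail P A p (measurable_tail^~ t) (tail_prob^~ t)
    (fun i j => @tail_prob_pair i j t) n _ np0.
  congr (_ <= _%:E)%E; field; rewrite !gt_eqF//.
apply: le_trans PL; rewrite -(measureU0 mL mU PU).
apply: le_measure; rewrite ?inE.
- apply: measurable_set_ltr; first exact: measurable_cst.
  apply: measurableT_comp => //; apply: measurable_funB => //.
  exact: measurable_endpoint_hat.
- exact: measurableU.
- move=> w /= bad; apply: contrapT => /not_orP[notL notU].
  move: bad; rewrite ltNge => /negP; apply.
  rewrite (_ : eps = 2 * (c - t)); last by rewrite /t; field.
  apply: endpoint_hat_near => //.
    move=> i ni; rewrite leNgt; apply/negP => cX; apply: notU.
    by rewrite /U -(bigcup_mkord n (fun i => X i @^-1` _)); exists i.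
  (* If the order statistic of rank n - 2 k + 1 is at most [t], fewer than 2 k observations exceed
     [t]; as 2 k <= n p / 2, this puts [w] in [L]. *)
  rewrite leNgt; apply/negP => /ltW/order_stat_le_count /=.
  rewrite subKn// => /(_ ltac:(lia)) hk; apply: notL.
  rewrite /L /A /= hits_count; apply: (@le_trans _ _ (2 * k)%:R).
    by rewrite ler_nat ltnW.
  by apply: le_trans knp _; lra.
Qed.

End iid_sample.

(** * Passage to the limit for fixed [eps] *)

Theorem theorem5 (d : measure_display) (T : measurableType d) (R : realType)
    (P : probability T R) (X : nat -> {RV P >-> R}) (F : R -> R)
    (hX : iid_with_cdf X F)
    (hxF : (right_endpoint F < +oo)%E)
    (a : R -> R)
    (ha : slowly_varying a)
    (ha_int : forall b c : R, 0 <= b -> b < c ->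
       integrable lebesgue_measure `]b, c] (EFin \o a))
    (ha_tail : forall t : R, 0 < t ->
       (\int[lebesgue_measure]_(s in `[t, +oo[) (a s / s)%:E < +oo)%E)
    (hU : (fun t : R => fine (tail_quantile_infty F) - fine (tail_quantile F t)) =
          (fun t : R => \int[lebesgue_measure]_(s in `[t, +oo[) (a s / s))
            +o_ (+oo_R) a)
    (k : nat -> nat)
    (hk_pos : forall n, (0 < k n)%N)
    (hk_infty : k n @[n --> \oo] --> \oo)
    (hk_n : (k n)%:R / n%:R @[n --> \oo] --> (0 : R)) :
  cvg_in_probability P
    (fun n w => endpoint_hat (fun i => X i w) n (k n))
    (fine (right_endpoint F)).
Proof.
move=> eps eps0.
set c := fine (right_endpoint F).
pose p := 1 - F (c - eps / 2).
have p0 : 0 < p.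
  by rewrite subr_gt0 (cdf_lt_endpoint _ _ _ hX hxF)// ltrBlDr ltrDl divr_gt0.
have p1 : p <= 1.
  rewrite -lee_fin -(tail_prob _ _ _ hX 0%N).
  by apply: probability_le1; exact: measurable_tail.
(* With [eps], hence [p], fixed, the bound of [endpoint_hat_tail] is of order 1 / n. *)
apply: (@squeeze_cvge _ _ _ _ (cst 0%E) _
  (fun n => (4 / p ^+ 2 * n%:R^-1)%:E)); last 2 first.
- exact: cvg_cst.
- apply: cvg_EFin; first by exact: nearW.
  rewrite -[X in _ --> X](mulr0 (4 / p ^+ 2)).
  apply: cvgM; first exact: cvg_cst.
  apply/gtr0_cvgV0; last exact: cvgr_idn.
  by near=> n; rewrite ltr0n; near: n; exact: nbhs_infty_gt.
(* The constant 1 / 4 is what gives 2 k <= n p / 2, as [endpoint_hat_tail] requires. *)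
have : \forall n \near \oo, (k n)%:R / n%:R < p / 4.
  by apply: (cvgr_lt _ hk_n); rewrite divr_gt0.
move=> hkn; near=> n; rewrite measure_ge0/=.
have n0 : (0 < n)%N by near: n; exact: nbhs_infty_gt.
have n0R : 0 < n%:R :> R by rewrite ltr0n.
have kn : (k n)%:R <= n%:R * p / 4.
  by rewrite -mulrA mulrC -ler_pdivrMr// ltW//; near: n.
apply: endpoint_hat_tail => //; last by rewrite natrM -/p; lra.
(* Since [p <= 1], the same bound also yields 2 k <= n. *)
rewrite -(ler_nat R) natrM; have : n%:R * p <= n%:R by rewrite ler_piMr// ltW.
lra.
Unshelve. all: by end_near. Qed.
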